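(* Let $X$ be a topological space. $B_1(X)$ with the $m_B$-topology is first countable if and only if $B_1(X)=B_1^*(X)$.
   Context: A Baire one function on a topological space $X$ is a function $f:X\to\mathbb{R}$ that is the pointwise limit of a sequence of continuous real-valued functions on $X$. $B_1(X)$ is the commutative ring, under pointwise operations, of all Baire one functions on $X$, and $B_1^*(X)$ is its subring of bounded functions. A positive unit of $B_1(X)$ is a unit $u$ of the ring $B_1(X)$ with $u(x)>0$ for all $x\in X$. The $m_B$-topology on $B_1(X)$ is the topology having as an open base the sets $\widetilde{M}(g,u)=\{f\in B_1(X): |f(x)-g(x)|<u(x)\text{ for every }x\in X\}$, where $g\in B_1(X)$ and $u$ is a positive unit of $B_1(X)$. *)

(* Defs.v *)
From HB Require Import structures.
From mathcomp Require Import all_boot all_order all_algebra.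
From mathcomp Require Import all_classical all_reals all_analysis.
Import Order.TTheory GRing.Theory Num.Theory.
Import numFieldNormedType.Exports.

Set Implicit Arguments.
Unset Strict Implicit.
Unset Printing Implicit Defensive.

Local Open Scope classical_set_scope.
Local Open Scope ring_scope.

(* The members of the local base are neighbourhoods, not necessarily open. *)
Definition first_countable (T : topologicalType) : Prop :=
  forall x : T, exists B : set (set T),
    [/\ countable B, B `<=` nbhs x &
        forall A : set T, nbhs x A -> exists2 U, B U & U `<=` A].

Section BaireOnePredicate.
Variables (R : realType) (X : topologicalType).
Implicit Types f g u : X -> R.

Definition is_baire_one f : Prop :=
  exists F : nat -> X -> R,
    (forall n, continuous (F n)) /\ forall x, F n x @[n --> \oo] --> f x.

Definition baire_one : {pred X -> R} := [pred f | `[< is_baire_one f >]].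

Lemma baire_oneP f : reflect (is_baire_one f) (f \in baire_one).
Proof. exact: asboolP. Qed.

Lemma is_baire_one_cst (c : R) : is_baire_one (cst c).
Proof.
by exists (fun=> cst c); split=> [n x|x]; exact: cvg_cst.
Qed.

Lemma is_baire_oneB f g :
  is_baire_one f -> is_baire_one g -> is_baire_one (fun x => f x - g x).
Proof.
move=> [F [Fc Ff]] [G [Gc Gg]]; exists (fun n x => F n x - G n x).
by split=> [n x|x]; apply: cvgB => //; [exact: Fc|exact: Gc].
Qed.

Lemma is_baire_oneM f g :
  is_baire_one f -> is_baire_one g -> is_baire_one (fun x => f x * g x).
Proof.
move=> [F [Fc Ff]] [G [Gc Gg]]; exists (fun n x => F n x * G n x).
by split=> [n x|x]; apply: cvgM => //; [exact: Fc|exact: Gc].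
Qed.

Lemma is_baire_one_norm f : is_baire_one f -> is_baire_one (fun x => `|f x|).
Proof.
move=> [F [Fc Ff]]; exists (fun n x => `|F n x|).
by split=> [n x|x]; apply: cvg_norm => //; exact: Fc.
Qed.

Lemma is_baire_one_min f g : is_baire_one f -> is_baire_one g ->
  is_baire_one (fun x => Num.min (f x) (g x)).
Proof.
move=> [F [Fc Ff]] [G [Gc Gg]]; exists (fun n x => Num.min (F n x) (G n x)).
split=> [n|x]; first by apply: min_fun_continuous; [exact: Fc|exact: Gc].
apply: (@continuous2_cvg _ _ _ _ _ _ _ _ (fun a b : R => Num.min a b)) => //.
exact: (@min_continuous _ R (f x, g x)).
Qed.

Lemma is_baire_oneV u : (forall x, 0 < u x) -> is_baire_one u ->
  is_baire_one (fun x => (u x)^-1).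
Proof.
move=> u0 [F [Fc Fu]].
exists (fun n x => (Num.max (F n x) n.+1%:R^-1)^-1); split=> [n x|x].
  apply: cvgV.
    by rewrite gt_eqF// lt_max invr_gt0 ltr0n orbT.
  apply: (@max_fun_continuous _ X R (F n) (cst n.+1%:R^-1)).
    exact: Fc.
  by move=> y; exact: cvg_cst.
apply: cvgV; first by rewrite gt_eqF.
rewrite -[X in _ --> X](max_l (ltW (u0 x))).
apply: (@continuous2_cvg _ _ _ _ _ _ _ _ (fun a b : R => Num.max a b)) => //.
- exact: (@max_continuous _ R (u x, 0)).
- exact: cvg_harmonic.
Qed.

Lemma baire_one_subring_closed : subring_closed baire_one.
Proof.
split=> [|f g /baire_oneP fP /baire_oneP gP|f g /baire_oneP fP /baire_oneP gP].
- exact/baire_oneP/is_baire_one_cst.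
- exact/baire_oneP/is_baire_oneB.
- exact/baire_oneP/is_baire_oneM.
Qed.

Record B1 := MkB1 {
  b1_fun :> X -> R;
  b1_funP : b1_fun \in baire_one
}.

HB.instance Definition _ := [isSub of B1 for b1_fun].
HB.instance Definition _ := [Choice of B1 by <:].
HB.instance Definition _ := GRing.SubChoice_isSubComPzRing.Build
  (X -> R) baire_one B1 baire_one_subring_closed.
HB.instance Definition _ := isPointed.Build B1 0.

End BaireOnePredicate.

Section mBTopology.
Variables (R : realType) (X : topologicalType).
Implicit Types f g h u v : B1 R X.

Lemma B1P f : is_baire_one f.
Proof. exact/baire_oneP/b1_funP. Qed.

Definition mkB1 (f : X -> R) (fP : is_baire_one f) : B1 R X :=
  MkB1 (introT (baire_oneP f) fP).

(* When X is empty B1 R X is the zero ring, so it carries no unitRingType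
   structure and GRing.unit is not available. *)
Definition b1_unit u : Prop := exists v, u * v = 1.

Definition positive_unit u : Prop := b1_unit u /\ forall x, 0 < u x.

Lemma positive_unitP u : positive_unit u <-> forall x, 0 < u x.
Proof.
split=> [[]//|u0]; split=> //.
exists (mkB1 (is_baire_oneV u0 (B1P u))).
apply/val_inj/funext => x.
exact: (divff (lt0r_neq0 (u0 x))).
Qed.

Definition Mtilde g u : set (B1 R X) :=
  [set f | forall x, `|f x - g x| < u x].

Definition mB_index : set (B1 R X * B1 R X) :=
  [set gu | positive_unit gu.2].

Definition mB_base (gu : B1 R X * B1 R X) : set (B1 R X) := Mtilde gu.1 gu.2.

Lemma mB_base_cover : \bigcup_(gu in mB_index) mB_base gu = setT.
Proof.
rewrite -subTset => f _; exists (f, 1).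
  by apply/positive_unitP => x; exact: ltr01.
by move=> x /=; rewrite subrr normr0; exact: ltr01.
Qed.

Lemma mB_base_join (i j : B1 R X * B1 R X) h :
  mB_index i -> mB_index j -> mB_base i h -> mB_base j h ->
  exists k, [/\ mB_index k, mB_base k h & mB_base k `<=` mB_base i `&` mB_base j].
Proof.
case: i j => [g1 u1] [g2 u2] _ _ /= h1 h2.
pose w (g u : B1 R X) x := u x - `|h x - g x|.
have wP g u : is_baire_one (w g u).
  by apply: is_baire_oneB (B1P u) _; exact/is_baire_one_norm/is_baire_oneB/B1P/B1P.
pose u := mkB1 (is_baire_one_min (wP g1 u1) (wP g2 u2)).
have u0 x : 0 < u x by rewrite /= lt_min !subr_gt0 h1 h2.
exists (h, u); split => [|x /=|f /= fh].
- exact/positive_unitP.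
- by rewrite subrr normr0; exact: u0.
- split=> x /=; have := fh x; rewrite /= lt_min => /andP[f1 f2].
  + rewrite ltrBrDr in f1; apply: le_lt_trans f1.
    by rewrite -[f x - _](subrKA (h x)); exact: ler_normD.
  + rewrite ltrBrDr in f2; apply: le_lt_trans f2.
    by rewrite -[f x - _](subrKA (h x)); exact: ler_normD.
Qed.

(* The m_B-topology is the only topology put on B1 R X; in particular it is not
   the subspace topology induced from X -> R. *)
HB.instance Definition _ :=
  isBaseTopological.Build (B1 R X) mB_base_cover mB_base_join.

Lemma mB_open (A : set (B1 R X)) :
  open A <-> exists2 D, D `<=` mB_index & \bigcup_(gu in D) mB_base gu = A.
Proof. by split=> -[D DI DA]; exists D. Qed.

Lemma mB_basis : basis (mB_base @` mB_index).
Proof.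
split=> [_ [gu guI <-]|f A].
  by apply/mB_open; exists [set gu]; [move=> _ -> | rewrite bigcup_set1].
rewrite nbhsE => -[U [/mB_open[D DI <-] [gu Dgu fgu]] UA].
exists (mB_base gu); first by split => //; exists gu => //; exact: DI.
by move=> h hgu; apply: UA; exists gu.
Qed.

Definition B1star : set (B1 R X) := [set f | bounded_fun (f : X -> R)].

End mBTopology.

Arguments B1star R X _ : clear implicits.

(* Main.v *)
(* If every Baire one function is bounded, so is 1/u for each positive unit u,
   hence u is bounded below by some 1/(n+1), and the sets M(g, 1/(n+1)) form a
   countable base at g.  Conversely, let f be unbounded and suppose 0 has a
   countable base, refined by sets M(0, u_n).  Choose points a_n with
   |f(a_n)| >= n + 1.  The sum psi = 1 + sum_n c_n max(0, |f| - n) is finite at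
   every point and is still Baire one, and psi(a_n) > c_n; with
   c_n = 2 / u_n(a_n) the neighbourhood M(0, 1/psi) contains none of the
   functions u_n/2, hence none of the M(0, u_n). *)
Require Import Defs.
From mathcomp Require Import all_boot all_order all_algebra.
From mathcomp Require Import all_classical all_reals all_analysis.
From mathcomp Require Import lra.
Import Order.TTheory GRing.Theory Num.Theory.
Import numFieldNormedType.Exports.
Local Open Scope classical_set_scope.

Section mBNeighbourhoods.
Local Open Scope ring_scope.
Context {R : realType} {X : topologicalType}.

Lemma nbhs_Mtilde (g u : B1 R X) : positive_unit u -> nbhs g (Mtilde g u).
Proof.
move=> uP; apply: open_nbhs_nbhs; split.
  by apply/mB_open; exists [set (g, u)]; [move=> _ -> | rewrite bigcup_set1].
by move=> x; rewrite subrr normr0; case: uP.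
Qed.

(** Recentring: if [g] lies in [Mtilde h u], then [u - |g - h|] is a positive Baire one function,
    and by the triangle inequality its ball at [g] stays inside [Mtilde h u]. *)
Lemma nbhs_Mtilde_sub (g : B1 R X) (A : set (B1 R X)) : nbhs g A ->
  exists2 u : B1 R X, positive_unit u & Mtilde g u `<=` A.
Proof.
rewrite nbhsE => -[U [/mB_open[D DI <-] [[h u] Dhu ghu]] UA].
have wP : is_baire_one (fun x => u x - `|g x - h x|).
  by apply: is_baire_oneB (B1P u) _; exact/is_baire_one_norm/is_baire_oneB/B1P/B1P.
exists (mkB1 wP).
  by apply/positive_unitP => x /=; rewrite subr_gt0; exact: ghu.
move=> f fgw; apply: UA; exists (h, u) => // x /=.
have := fgw x; rewrite /= ltrBrDr; apply: le_lt_trans.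
by rewrite -[f x - _](subrKA (g x)); exact: ler_normD.
Qed.

(** An arbitrary filter serves both continuity in the point and convergence in the sequence
    index. *)
Lemma cvg_sum_max_subn {T : Type} {F : set_system T} {FF : Filter F}
    (c : nat -> R) (h : T -> R) (l : R) (k : nat) :
  h t @[t --> F] --> l ->
  \sum_(n < k) c n * Num.max 0 (`|h t| - n%:R) @[t --> F] -->
  \sum_(n < k) c n * Num.max 0 (`|l| - n%:R).
Proof.
move=> hl; apply: cvg_big => [|n _]; first exact: add_continuous.
apply: cvgM; first exact: cvg_cst.
apply: (@continuous2_cvg _ _ _ _ _ _ _ _ (fun a b : R => Num.max a b)).
- exact: (@max_continuous _ R (0, `|l| - n%:R)).
- exact: cvg_cst.
- by apply: cvgB; [exact: cvg_norm|exact: cvg_cst].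
Qed.

(** The approximants use [F k] and [k] terms, hence are continuous. At a fixed [x], eventually
    [|F k x| < N], so the terms from [N] on vanish and a sum of fixed length remains. *)
Lemma is_baire_one_locally_finite_sum (c : nat -> R) (f : X -> R) :
  is_baire_one f ->
  is_baire_one (fun x => 1 + \sum_(n < (Num.truncn `|f x|).+1)
    c n * Num.max 0 (`|f x| - n%:R)).
Proof.
move=> [F [Fc Ff]].
exists (fun k x => 1 + \sum_(n < k) c n * Num.max 0 (`|F k x| - n%:R)).
split=> [k x|x].
  by apply: cvgD; [exact: cvg_cst|apply: cvg_sum_max_subn; exact: Fc].
set N := (Num.truncn `|f x|).+1.
have fN : `|f x| < N%:R by exact: truncnS_gt.
have nF : `|F k x| @[k --> \oo] --> `|f x| by apply: cvg_norm; exact: Ff.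
apply: (@cvg_trans _ ((fun k => 1 + \sum_(n < N)
    c n * Num.max 0 (`|F k x| - n%:R)) @ \oo)); last first.
  by apply: cvgD; [exact: cvg_cst|apply: cvg_sum_max_subn; exact: Ff].
apply: near_eq_cvg; near=> k.
have Nk : (N <= k)%N by near: k; exact: nbhs_infty_ge.
have FN : `|F k x| < N%:R by near: k; exact: (cvgr_lt _ nF).
congr (1 + _).
rewrite (big_ord_widen k (fun n => c n * Num.max 0 (`|F k x| - n%:R)) Nk).
rewrite [RHS](bigID (fun n : 'I_k => (n < N)%N)) /=.
rewrite [X in _ = _ + X]big1 ?addr0// => n; rewrite -leqNgt => Nn.
by rewrite max_l ?mulr0// subr_le0 (le_trans (ltW FN))// ler_nat.
Unshelve. all: by end_near. Qed.

Lemma unbounded_positive_unit_lt (f : B1 R X) (u : nat -> B1 R X) :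
  ~ bounded_fun (f : X -> R) -> (forall n x, 0 < u n x) ->
  exists2 v : B1 R X, positive_unit v & forall n, exists x, v x < u n x.
Proof.
move=> fub u0.
have /choice[a fa] (n : nat) : exists x, n.+1%:R <= `|f x|.
  apply: contrapT => /forallNP fn; apply: fub.
  exists n.+1%:R; split=> [|M nM x _]; first exact: num_real.
  by apply: ltW; apply: lt_trans nM; rewrite ltNge; exact/negP/fn.
pose c n := (u n (a n))^-1.
have c0 n : 0 < c n by rewrite invr_gt0.
have psiP := is_baire_one_locally_finite_sum c _ (B1P f).
set psi := (X in is_baire_one X) in psiP.
(* [P] allows both the full sum and the sum with one index removed. *)
have sum0 x (P : pred _) : 0 <= \sum_(n < (Num.truncn `|f x|).+1 | P n)
    c n * Num.max 0 (`|f x| - n%:R).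
  by apply: sumr_ge0 => n _; rewrite mulr_ge0 ?(ltW (c0 _))// le_max lexx.
have psi0 x : 0 < psi x by rewrite ltr_wpDr.
exists (mkB1 (is_baire_oneV psi0 psiP)).
  by apply/positive_unitP => x /=; rewrite invr_gt0.
move=> n; exists (a n) => /=.
(* After inversion the goal is [c n < psi (a n)]: the term of index [n] is at least [c n], since
   [|f (a n)| - n >= 1], and the summand 1 makes it strict. *)
rewrite -[ltRHS]invrK ltf_pV2 ?posrE ?c0 ?psi0// -/(c n).
have nN : (n < (Num.truncn `|f (a n)|).+1)%N.
  by rewrite ltnS truncn_ge_nat// (le_trans _ (fa n))// ler_nat.
rewrite /psi (bigD1 (Ordinal nN)) //=.
have := sum0 (a n) (fun i => i != Ordinal nN).
have : c n * 1 <= c n * Num.max 0 (`|f (a n)| - n%:R).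
  rewrite ler_pM2l ?c0// le_max lerBrDr addrC natr1.
  by rewrite fa orbT.
lra.
Qed.

End mBNeighbourhoods.

Theorem theorem2p19 (R : realType) (X : topologicalType) :
  first_countable (B1 R X) <-> [set: B1 R X] = B1star R X.
Proof.
split=> [fc|all_bounded g].
- apply/seteqP; split=> // f _; apply: contrapT => fub.
  have [B [Bc Bnbhs Bbase]] := fc 0%R.
  (* Either [B] is empty, which the neighbourhood [setT] rules out, or [W] enumerates it. *)
  have [B0|[W]] := pfcard_geP Bc.
    by have [U] := Bbase setT filterT; rewrite B0.
  have /choice[u uP] n : exists u : B1 R X,
      positive_unit u /\ Mtilde 0%R u `<=` W n.
    have BW : B (W n) by exact: funS.
    by have [u] := nbhs_Mtilde_sub _ _ (Bnbhs _ BW); exists u.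
  have half_gt0 n x : (0 < 2^-1 * u n x)%R.
    by rewrite mulr_gt0 ?invr_gt0//; case: (uP n) => -[].
  (* Half of [u n] lies in [Mtilde 0 (u n)]; [u n] itself does not, the inequality being strict. *)
  pose h n := mkB1 (is_baire_oneM (is_baire_one_cst X 2^-1%R) (B1P (u n))).
  have [v vP vh] := unbounded_positive_unit_lt f h fub half_gt0.
  have [U BU Uv] := Bbase _ (nbhs_Mtilde 0%R v vP).
  have [n _ WnU] := 'surj_W BU.
  have [x] := vh n; apply/negP; rewrite -leNgt ltW//.
  have /Uv/(_ x) : U (h n).
    rewrite -WnU; apply: (uP n).2 => y /=.
    have := half_gt0 n y.
    rewrite [X in `|X|%R](_ : _ = (2^-1 * u n y)%R); last exact: subr0.
    by move=> h0; rewrite gtr0_norm//; lra.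
  rewrite [X in `|X|%R](_ : _ = h n x); last exact: subr0.
  by apply: le_lt_trans; exact: ler_norm.
- pose e n : B1 R X := mkB1 (is_baire_one_cst X n.+1%:R^-1%R).
  have eP n : positive_unit (e n).
    by apply/positive_unitP => x /=; rewrite invr_gt0.
  exists (range (fun n => Mtilde g (e n))); split.
  + exact: sub_countable (card_image_le _ _) (countableP _).
  + by move=> _ [n _ <-]; exact: nbhs_Mtilde.
  + move=> A /nbhs_Mtilde_sub[u /positive_unitP u0 uA].
    have : [set: B1 R X] (mkB1 (is_baire_oneV u0 (B1P u))) by [].
    rewrite all_bounded => -[M [_ uM]].
    pose n := Num.truncn `|M|%R.
    (* Boundedness gives [|1 / u| <= M'] only for [M'] strictly above [M]; here [M' = n + 1]. *)
    have Mn : (M < n.+1%:R)%R.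
      by rewrite (le_lt_trans (ler_norm M))// truncnS_gt.
    exists (Mtilde g (e n)); first by exists n.
    move=> f fge; apply: uA => x; apply: lt_le_trans (fge x) _ => /=.
    rewrite -[leRHS]invrK lef_pV2 ?posrE ?invr_gt0 ?ltr0n//.
    by apply: le_trans (uM _ Mn x I); exact: ler_norm.
Qed.
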